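(* Let $(\Omega,\mathscr{H},\widehat{E})$ be a sub-linear expectation space with conjugate expectation $\widehat{\mathcal{E}}$ and upper capacity $\mathbb{V}$, and let $\{X_n; n\geq 1\}\subset\mathscr{H}$ be a sequence of independent random variables in $(\Omega,\mathscr{H},\widehat{E})$. Suppose that $\mathbb{V}$ is countably sub-additive, that the series $\sum_{n=1}^{\infty}\widehat{E}[X_n]$ and $\sum_{n=1}^{\infty}\widehat{\mathcal{E}}[X_n]$ both converge (as series of real numbers), and that there exists $p$ with $1\leq p\leq 2$ such that $\sum_{n=1}^{\infty}\widehat{E}[|X_n|^p]<\infty$. Then $\sum_{n=1}^{\infty}X_n$ converges almost surely in capacity (a.s. $\mathbb{V}$).
   Context: Let $(\Omega,\mathcal{F})$ be a measurable space and let $\mathscr{H}$ be a linear space of real ($\mathcal{F}$-measurable) functions on $\Omega$ such that $X_1,\ldots,X_n\in\mathscr{H}$ implies $\varphi(X_1,\ldots,X_n)\in\mathscr{H}$ for every $\varphi\in C_{l,Lip}(\mathbb{R}^n)$. Here $C_{l,Lip}(\mathbb{R}^n)$ is the linear space of functions $\varphi:\mathbb{R}^n\to\mathbb{R}$ satisfying $|\varphi(x)-\varphi(y)|\leq C(1+|x|^m+|y|^m)|x-y|$ for all $x,y\in\mathbb{R}^n$, for some $C>0$ and $m\in\mathbb{N}$ depending on $\varphi$. Elements of $\mathscr{H}$ are called random variables. A sub-linear expectation on $\mathscr{H}$ is a function $\widehat{E}:\mathscr{H}\to[-\infty,+\infty]$ such that for all $X,Y\in\mathscr{H}$: (a) $X\geq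 Y$ implies $\widehat{E}[X]\geq\widehat{E}[Y]$; (b) $\widehat{E}[c]=c$ for constants $c$; (c) $\widehat{E}[X+Y]\leq\widehat{E}[X]+\widehat{E}[Y]$ whenever the right-hand side is not of the form $+\infty-\infty$ or $-\infty+\infty$; (d) $\widehat{E}[\lambda X]=\lambda\widehat{E}[X]$ for $\lambda\geq 0$. The triple $(\Omega,\mathscr{H},\widehat{E})$ is called a sub-linear expectation space. The conjugate expectation is $\widehat{\mathcal{E}}[X]:=-\widehat{E}[-X]$. The upper capacity generated by $\widehat{E}$ is $\mathbb{V}(A):=\inf\{\widehat{E}[\xi]: I_A\leq\xi,\ \xi\in\mathscr{H}\}$ for $A\in\mathcal{F}$, where $I_A$ is the indicator function of $A$. $\mathbb{V}$ is called countably sub-additive if $\mathbb{V}(\bigcup_{n=1}^{\infty}A_n)\leq\sum_{n=1}^{\infty}\mathbb{V}(A_n)$ for all $A_n\in\mathcal{F}$. A property holds almost surely in capacity (a.s. $\mathbb{V}$) if the set $N\in\mathcal{F}$ where it fails satisfies $\mathbb{V}(N)=0$; convergence of a random series means convergence of its partial sums to a finite limit. Independence: a random vector $\mathbf{Y}=(Y_1,\ldots,Y_n)$ ($Y_i\in\mathscr{H}$) is independent to a random vector $\mathbf{X}=(X_1,\ldots,X_m)$ ($X_i\in\mathscr{H}$) under $\widehat{E}$ if for each $\varphi\in C_{l,Lip}(\mathbb{R}^m\times\mathbb{R}^n)$ one has $\widehat{E}[\varphi(\mathbf{X},\mathbf{Y})]=\widehat{E}\big[\widehat{E}[\varphi(\mathbf{x},\mathbf{Y})]|_{\mathbf{x}=\mathbf{X}}\big]$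 whenever $\overline{\varphi}(\mathbf{x}):=\widehat{E}[\varphi(\mathbf{x},\mathbf{Y})]<\infty$ for all $\mathbf{x}$ and $\widehat{E}[|\overline{\varphi}(\mathbf{X})|]<\infty$. A sequence $\{X_n;n\geq1\}$ of random variables is independent if $X_{i+1}$ is independent to $(X_1,\ldots,X_i)$ for each $i\geq 1$. *)

(* Defs.v *)
From HB Require Import structures.
From mathcomp Require Import all_boot all_order all_algebra.
From mathcomp Require Import all_classical all_reals all_analysis.

Set Implicit Arguments.
Unset Strict Implicit.
Unset Printing Implicit Defensive.

Import Order.TTheory GRing.Theory Num.Theory.
Import numFieldNormedType.Exports.

Local Open Scope classical_set_scope.
Local Open Scope ring_scope.
Local Open Scope ereal_scope.

(* C_{l,Lip}(R^n), with R^n rendered as row vectors. `|x| is the library norm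
   of 'rV[R]_n (the max norm); all norms on R^n define the same class, only
   the constant C changes. *)
Definition locally_lipschitz_poly (R : realType) (n : nat)
    (phi : 'rV[R]_n -> R) : Prop :=
  exists (C : R) (m : nat), (0 < C)%R /\
    forall x y : 'rV[R]_n,
      (`|phi x - phi y| <= C * (1 + `|x| ^+ m + `|y| ^+ m) * `|x - y|)%R.

Definition random_vector (R : realType) (Omega : Type) (n : nat)
    (X : 'I_n -> Omega -> R) (w : Omega) : 'rV[R]_n := \row_i X i w.

Record random_variable_space (R : realType) (d : measure_display)
    (Omega : measurableType d) (H : set (Omega -> R)) : Prop := {
  rvs_measurable : forall X, H X -> measurable_fun [set: Omega] X ;
  rvs_zero : H (fun=> 0%R) ;
  rvs_linear : forall (a : R) (X Y : Omega -> R), H X -> H Y ->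
    H (fun w => a * X w + Y w)%R ;
  rvs_comp : forall (n : nat) (phi : 'rV[R]_n -> R) (X : 'I_n -> Omega -> R),
    locally_lipschitz_poly phi -> (forall i, H (X i)) ->
    H (fun w => phi (random_vector X w)) }.

(* The functional E is total on functions Omega -> R, but it is constrained,
   and below only ever evaluated, on members of H. *)
Record sublinear_expectation (R : realType) (Omega : Type)
    (H : set (Omega -> R)) (E : (Omega -> R) -> \bar R) : Prop := {
  sle_mono : forall X Y, H X -> H Y -> (forall w, (Y w <= X w)%R) ->
    E Y <= E X ;
  sle_cst : forall c : R, E (fun=> c) = c%:E ;
  (* +? excludes exactly the forms +oo - oo and -oo + oo *)
  sle_subadd : forall X Y, H X -> H Y -> E X +? E Y ->
    E (fun w => X w + Y w)%R <= E X + E Y ;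
  sle_homo : forall (l : R) X, H X -> (0 <= l)%R ->
    E (fun w => l * X w)%R = l%:E * E X }.

Definition sublinear_expectation_space (R : realType) (d : measure_display)
    (Omega : measurableType d) (H : set (Omega -> R))
    (E : (Omega -> R) -> \bar R) : Prop :=
  random_variable_space H /\ sublinear_expectation H E.

Definition conjugate_expectation (R : realType) (Omega : Type)
    (E : (Omega -> R) -> \bar R) (X : Omega -> R) : \bar R :=
  - E (fun w => - X w)%R.

Definition upper_capacity (R : realType) (Omega : Type)
    (H : set (Omega -> R)) (E : (Omega -> R) -> \bar R)
    (A : set Omega) : \bar R :=
  ereal_inf [set E xi | xi in
    [set xi | H xi /\ forall w, (\1_A w <= xi w)%R]].

Definition countably_subadditive (R : realType) (d : measure_display)
    (Omega : measurableType d) (V : set Omega -> \bar R) : Prop :=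
  forall A : nat -> set Omega, (forall n, measurable (A n)) ->
    V (\bigcup_n A n) <= \sum_(0 <= n <oo) V (A n).

Definition almost_surely_in_capacity (R : realType) (d : measure_display)
    (Omega : measurableType d) (V : set Omega -> \bar R)
    (P : Omega -> Prop) : Prop :=
  measurable [set w | ~ P w] /\ V [set w | ~ P w] = 0.

(* Y is independent to X. Since E acts on H only, the expectations of
   phibar(X) and |phibar(X)| presuppose that phibar(X) is (real-valued and) a
   member of H; Z is that member. *)
Definition independent_to (R : realType) (Omega : Type)
    (H : set (Omega -> R)) (E : (Omega -> R) -> \bar R) (m n : nat)
    (Y : 'I_n -> Omega -> R) (X : 'I_m -> Omega -> R) : Prop :=
  forall phi : 'rV[R]_(m + n) -> R, locally_lipschitz_poly phi ->
  let phibar (x : 'rV[R]_m) : \bar R :=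
    E (fun w => phi (row_mx x (random_vector Y w))) in
  (forall x, phibar x < +oo) ->
  forall Z : Omega -> R, H Z ->
    (forall w, phibar (random_vector X w) = (Z w)%:E) ->
    E (fun w => `|Z w|%R) < +oo ->
    E (fun w => phi (row_mx (random_vector X w) (random_vector Y w))) = E Z.

(* Sequences are indexed from 0: X k stands for X_(k+1). *)
Definition independent_sequence (R : realType) (Omega : Type)
    (H : set (Omega -> R)) (E : (Omega -> R) -> \bar R)
    (X : nat -> Omega -> R) : Prop :=
  forall i : nat,
    independent_to H E (fun _ : 'I_1 => X i.+1) (fun j : 'I_i.+1 => X j).

(* Convergence to a finite limit of a series whose terms, a priori extended,
   are all real. *)
Definition real_series_converges (R : realType) (u : nat -> \bar R) : Prop :=
  (forall n, u n \is a fin_num) /\ cvgn (series (fun n => fine (u n))).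

(* Main.v *)
Require Import Defs.
From HB Require Import structures.
From mathcomp Require Import all_boot all_order all_algebra.
From mathcomp Require Import all_classical all_reals all_analysis.
From mathcomp Require Import ring lra zify.

(** Centre the summands at their upper means: [Y_k = X_k - E[X_k]].  Then
    [E[Y_k] = 0] and [E[- Y_k] = d_k], where [d_k >= 0] is the difference of the
    upper and the lower mean of [X_k].  Both series of means converge, so
    [sum d_k] is finite, and the series of the [X_k] and of the [Y_k] converge
    together.

    The heart of the proof is a maximal inequality for a finite block
    [N <= k < n].  Let [h] be the Huber function: convex, quadratic near [0],
    linear at infinity, with derivative bounded by [2].  Since
    [h(s + y) <= h(s) + h'(s) y + 4 h(y)], the value [h(S_k)] of a partial sum
    grows by at most a drift [h'(S_k) Y_k] and an error [4 h(Y_k)].  Stopping at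
    the first exit from an interval is not a Lipschitz operation, so it is
    replaced by a survival weight [R_k], the product of Lipschitz cutoffs of the
    successive partial sums: it vanishes once a partial sum has left [[-2, 2]].
    Pathwise,
      [1 - R_n <= sum_k (R_k h'(S_k) Y_k + 4 h(Y_k))]
    ([stopping_le_drift]).  The right-hand side is a random variable dominating
    the indicator of the event that some partial sum of the block reaches [2].
    The coefficient [R_k h'(S_k)] is a bounded Lipschitz function of the past,
    so independence bounds the upper mean of the drift by [2 d_k]
    ([independent_drift]); this is the only use of independence.  The error is
    bounded through [h(x) <= 2 |x|^p], valid for every [1 <= p <= 2], and a
    Jensen inequality which controls [h(E[X_k])] ([huber_jensen]).  Applied to
    [t Y_k] with [t >= 1], this gives [block_capacity_le]: the capacity of
    [max |S_k| >= 2 / t] over the block is at most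
    [t^2 sum_k (2 d_k + 32 E[|X_k|^p])].

    A capacity which is only countably sub-additive need not be continuous along
    increasing unions, so the maximal inequality does not extend to infinite
    blocks.  Instead, time is cut into finite blocks [[N_j, N_{j+1}]] on which
    the maximum exceeds [2^-j] with capacity at most [2^-(j+1)]
    ([fast_block_ends]); by Borel-Cantelli, outside a set of capacity zero all
    but finitely many blocks oscillate by at most [2^-j], which makes the partial
    sums Cauchy ([geometric_blocks_cvg]). *)

Import Order.TTheory GRing.Theory Num.Theory.
Import numFieldNormedType.Exports.

Local Open Scope classical_set_scope.
Local Open Scope ring_scope.
Local Open Scope ereal_scope.

Set Implicit Arguments.
Unset Strict Implicit.
Unset Printing Implicit Defensive.

(** * The Huber function, the cutoff and powers *)
Section RealFunctions.
Local Open Scope ring_scope.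
Variable R : realType.
Implicit Types s t x y c p : R.

Definition clamp x : R := Num.max (-1) (Num.min 1 x).

(** The square on [[-1, 1]], extended affinely with slopes [-2] and [2]; its
    derivative is [2 * clamp x]. *)
Definition huber x : R := clamp x * (2 * x - clamp x).

(** A Lipschitz bump equal to [1] on [[-1, 1]] and to [0] outside [[-2, 2]].
    Expressing it by [clamp] makes its Lipschitz bound that of [clamp]. *)
Definition cutoff x : R := (1 + clamp (3 - 2 * `|x|)) / 2.

Lemma clampP x : [\/ x <= -1 /\ clamp x = -1,
  -1 <= x <= 1 /\ clamp x = x | 1 <= x /\ clamp x = 1].
Proof.
rewrite /clamp; have [x1|x1] := leP 1 x.
  by apply: Or33; split => //; apply/max_idPr; lra.
have [x0|x0] := leP (-1) x; first by apply: Or32; split => //; lra.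
by apply: Or31; split => //; lra.
Qed.

Lemma clamp_le1 x : `|clamp x| <= 1.
Proof. by rewrite ler_norml; case: (clampP x) => -[? ->]; lra. Qed.

Lemma clamp_lipschitz x y : `|clamp x - clamp y| <= `|x - y|.
Proof.
wlog xy : x y / x <= y => [hw|].
  have [/hw //|/ltW /hw] := leP x y.
  by rewrite distrC (distrC y).
rewrite (distrC x) (distrC (clamp x)) (@ger0_norm _ (y - x)) ?subr_ge0 //.
rewrite ler_norml.
by case: (clampP x) => -[? ->]; case: (clampP y) => -[? ->]; lra.
Qed.

Lemma cutoff_ge0 x : 0 <= cutoff x.
Proof. by rewrite /cutoff; case: (clampP (3 - 2 * `|x|)) => -[? ->]; lra. Qed.

Lemma cutoff_le1 x : cutoff x <= 1.
Proof. by rewrite /cutoff; case: (clampP (3 - 2 * `|x|)) => -[? ->]; lra. Qed.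

Lemma cutoff_eq0 x : 2 <= `|x| -> cutoff x = 0.
Proof. by rewrite /cutoff; case: (clampP (3 - 2 * `|x|)) => -[? ->]; lra. Qed.

Lemma cutoff_lipschitz x y : `|cutoff x - cutoff y| <= `|x - y|.
Proof.
have := ler_dist_dist x y; rewrite ler_norml => /andP[h1 h2].
have h : `|3 - 2 * `|x| - (3 - 2 * `|y|)| <= 2 * `|x - y|.
  by rewrite ler_norml; lra.
have := le_trans (clamp_lipschitz _ _) h.
by rewrite /cutoff !ler_norml; lra.
Qed.

Lemma huber_ge0 x : 0 <= huber x.
Proof. by rewrite /huber; case: (clampP x) => -[? ->]; nra. Qed.

Lemma huber0 : huber 0 = 0 :> R.
Proof. by rewrite /huber; case: (clampP 0) => -[? ->]; nra. Qed.

(** What makes fractional stopping harmless: [cutoff] drops below [1] only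
    where [huber] is already at least [1], so exchanging the current level of
    [huber] for a unit of stopped mass never increases the total. *)
Lemma cutoff_huber x : 1 - cutoff x + cutoff x * huber x <= huber x.
Proof.
have [x1|x1] := leP `|x| 1.
  have -> : cutoff x = 1; last lra.
  by rewrite /cutoff; case: (clampP (3 - 2 * `|x|)) => -[? ->]; lra.
have h1 : 1 <= huber x.
  move: x1; rewrite /huber ltr_normr => /orP x1.
  by case: (clampP x) => -[? ->]; case: x1; lra.
by have := cutoff_le1 x; nra.
Qed.

(** The Huber function is the upper envelope of the affine functions
    [2 l x - l^2] with [|l| <= 1]: convexity and the scaling bounds below follow
    by choosing [l], without differentiating. *)
Lemma huber_max l x : `|l| <= 1 -> l * (2 * x - l) <= huber x.
Proof.
rewrite ler_norml => /andP[l1 l2]; rewrite /huber.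
case: (clampP x) => -[xl ->].
- have : 0 <= (1 + l) * ((1 + l) + 2 * (-1 - x)) by rewrite mulr_ge0//; lra.
  by lra.
- have : 0 <= (x - l) ^+ 2 by rewrite sqr_ge0.
  by lra.
- have : 0 <= (1 - l) * ((1 - l) + 2 * (x - 1)) by rewrite mulr_ge0//; lra.
  by lra.
Qed.

Lemma huber_tangent s x : huber s + 2 * clamp s * (x - s) <= huber x.
Proof. by have := huber_max x (clamp_le1 s); rewrite /(huber s); lra. Qed.

(** The remainder is at most [2 |clamp (s + y) - clamp s| |y|], hence at most
    [2 y^2] and at most [4 |y|]; whichever is smaller is below [4 huber y]. *)
Lemma huber_taylor s y :
  huber (s + y) <= huber s + 2 * clamp s * y + 4 * huber y.
Proof.
have hm := huber_max s (clamp_le1 (s + y)).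
suff : 2 * (clamp (s + y) - clamp s) * y <= 4 * huber y.
  by move: hm; rewrite /(huber (s + y)); lra.
have d1 := clamp_lipschitz (s + y) s; rewrite addrAC subrr add0r in d1.
have d2 : `|clamp (s + y) - clamp s| <= 2.
  have := clamp_le1 (s + y); have := clamp_le1 s.
  by rewrite !ler_norml; lra.
apply: (@le_trans _ _ (2 * (`|clamp (s + y) - clamp s| * `|y|))).
  by rewrite -normrM -mulrA ler_pM2l // ler_norm.
move: d1 d2; have := normr_ge0 (clamp (s + y) - clamp s).
move: `|clamp _ - _| => d d0 d1 d2; rewrite /huber.
case: (clampP y) => -[y1 ->].
- by move: d1; rewrite ler0_norm; nra.
- have : d * `|y| <= y * y by rewrite -expr2 -real_normK ?num_real // expr2; nra.
  by nra.
- by move: d1; rewrite ger0_norm; nra.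
Qed.

Lemma huberB x y : huber (x - y) <= 2 * (huber x + huber y).
Proof.
have h := clamp_le1 (x - y).
have hx : `|clamp (x - y) / 2| <= 1 by move: h; rewrite !ler_norml; lra.
have hy : `|- (clamp (x - y) / 2)| <= 1 by rewrite normrN.
have := huber_max x hx; have := huber_max y hy.
by rewrite /(huber (x - y)); lra.
Qed.

Lemma huberM t x : 1 <= t -> huber (t * x) <= t ^+ 2 * huber x.
Proof.
move=> t1; have h := clamp_le1 (t * x).
have ht : `|clamp (t * x) / t| <= 1.
  rewrite normrM normfV (@ger0_norm _ t); last lra.
  by rewrite ler_pdivrMr; lra.
have := huber_max x ht; rewrite -(@ler_pM2l _ (t ^+ 2)); last nra.
suff -> : t ^+ 2 * (clamp (t * x) / t * (2 * x - clamp (t * x) / t)) =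
   huber (t * x) by [].
by rewrite /huber; field; lra.
Qed.

Lemma huber_le_powR x p : 1 <= p <= 2 -> huber x <= 2 * `|x| `^ p.
Proof.
move=> /andP[p1 p2]; have [x1|x1] := leP 1 `|x|.
  apply: (@le_trans _ _ (2 * `|x|)); last first.
    by rewrite ler_pM2l // le1r_powR.
  have h1 := ler_norm x; have h2 : - x <= `|x| by rewrite -normrN ler_norm.
  rewrite /huber; case: (clampP x) => -[? ->]; nra.
have [->|x0] := eqVneq x 0.
  by rewrite huber0 normr0 mulr_ge0 ?powR_ge0.
apply: (@le_trans _ _ (2 * `|x| `^ 2)); last first.
  rewrite ler_pM2l //; apply: ger_powR => //.
  by rewrite normr_gt0 x0 ltW.
rewrite powR_mulrn // real_normK ?num_real //.
by rewrite /huber; case: (clampP x) => -[? ->]; nra.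
Qed.

(** Write [x^p - y^p = (x - y) x^(p-1) + y (x^(p-1) - y^(p-1))].  As
    [p - 1 <= 1], the ratio [(x / y)^(p-1)] is at most [x / y], which bounds the
    second term by [(x - y) y^(p-1)]. *)
Lemma powR_subM p x y : 0 <= y <= x -> 1 <= p <= 2 ->
  x `^ p - y `^ p <= 2 * (1 + x) * (x - y).
Proof.
move=> /andP[y0 yx] /andP[p1 p2].
have x0 := le_trans y0 yx.
have r0 : 0 <= p - 1 by lra.
have r1 : p - 1 <= 1 by lra.
have p0 : 0 < p by lra.
have powle z : 0 <= z -> z `^ (p - 1) <= 1 + z.
  move=> z0; have [z1|z1] := leP 1 z.
    by apply: (le_trans (ler1_powR z1 _)); lra.
  apply: (@le_trans _ _ (1 `^ (p-1))); last by rewrite powR1; lra.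
  by apply: ge0_ler_powR => //; rewrite ?nnegrE // ltW.
have sub : y * (x `^ (p - 1) - y `^ (p - 1)) <= y `^ (p - 1) * (x - y).
  have [->|yn0] := eqVneq y 0.
    by rewrite mul0r mulr_ge0 ?powR_ge0 ?subr0.
  have yp : 0 < y by rewrite lt0r yn0.
  have -> : x `^ (p - 1) = y `^ (p - 1) * (x / y) `^ (p - 1).
    by rewrite -powRM ?divr_ge0 // mulrC divfK.
  have : (x / y) `^ (p - 1) <= x / y.
    by apply: ler1_powR; [rewrite ler_pdivlMr ?mul1r|].
  rewrite -(ler_pM2r yp) divfK // => h.
  rewrite -{2}[y `^ (p - 1)]mulr1 -mulrBr mulrCA.
  by rewrite ler_wpM2l ?powR_ge0 // mulrBr mulr1 lerB // mulrC.
rewrite -(mulr_powRB1 x0 p0) -(mulr_powRB1 y0 p0).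
have := powle _ x0; have := powle _ y0; move: sub.
move: (x `^ (p - 1)) (y `^ (p - 1)) => a b; nra.
Qed.

(** The form in which [|x|^p] is seen to be locally Lipschitz with polynomial
    growth, so that [|X|^p] is a random variable. *)
Lemma norm_powR_lipschitz p x y : 1 <= p <= 2 ->
  `| `|x| `^ p - `|y| `^ p| <= 2 * (1 + `|x| + `|y|) * `|x - y|.
Proof.
move=> p12; wlog xy : x y / `|y| <= `|x| => [hw|].
  have [/hw //|/ltW /hw] := leP `|y| `|x|.
  by rewrite distrC (distrC y) -!addrA (addrC `|x|).
rewrite ger0_norm; last first.
  by rewrite subr_ge0 ge0_ler_powR ?nnegrE //; case/andP: p12; lra.
have := @powR_subM p `|x| `|y|; rewrite xy normr_ge0 => /(_ isT p12).
have := ler_dist_dist x y; rewrite ger0_norm ?subr_ge0 //.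
have := normr_ge0 y; move: (normr_ge0 x) => ? ? ? ?; nra.
Qed.

End RealFunctions.

(** * Locally Lipschitz functions of row vectors *)
Section RowVectors.
Local Open Scope ring_scope.
Variable R : realType.

Lemma coord_le_norm (n : nat) (x : 'rV[R]_n) j : `|x 0 j| <= `|x|.
Proof.
rewrite [in leRHS]/Num.norm /= mx_normrE.
exact: (le_bigmax _ (fun ij => `|x ij.1 ij.2|) (0, j)).
Qed.

Lemma norm_lsubmx_le (m n : nat) (z : 'rV[R]_(m + n)) : `|lsubmx z| <= `|z|.
Proof.
rewrite [in leLHS]/Num.norm /= mx_normrE.
apply: bigmax_le => // -[i j] _; rewrite !mxE (ord1 i).
exact: coord_le_norm.
Qed.

Lemma locally_lipschitz_poly_coord (f : R -> R) (C : R) : 0 < C ->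
  (forall x y, `|f x - f y| <= C * (1 + `|x| + `|y|) * `|x - y|) ->
  locally_lipschitz_poly (fun x : 'rV[R]_1 => f (x 0 0)).
Proof.
move=> C0 fC; exists C, 1%N; split=> // x y; rewrite !expr1.
apply: (le_trans (fC _ _)).
have := coord_le_norm (x - y) 0; rewrite !mxE => hd.
have hx := coord_le_norm x 0; have hy := coord_le_norm y 0.
apply: ler_pM => //; first by rewrite mulr_ge0 ?addr_ge0 // ltW.
by rewrite ler_pM2l // lerD // lerD.
Qed.

Lemma lipschitz_locally_poly (n : nat) (f : 'rV[R]_n -> R) (L : R) :
  (forall x y, `|f x - f y| <= L * `|x - y|) -> locally_lipschitz_poly f.
Proof.
move=> fL; exists (`|L| + 1), 0%N; split=> [|x y].
  by rewrite ltr_wpDl.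
apply: (le_trans (fL x y)); rewrite !expr0 ler_wpM2r //.
by have := ler_norm L; have := normr_ge0 L; lra.
Qed.

(** The test functions to which independence is applied: a bounded Lipschitz
    weight on the past times the centred new coordinate.  Boundedness of the
    weight keeps the growth linear. *)
Lemma locally_lipschitz_poly_mul_last (m : nat) (a : 'rV[R]_m -> R) (K L c : R) :
  (forall x, `|a x| <= K) -> (forall x y, `|a x - a y| <= L * `|x - y|) ->
  locally_lipschitz_poly
    (fun z : 'rV[R]_(m + 1) => a (lsubmx z) * (rsubmx z 0 0 - c)).
Proof.
move=> aK aL; have K0 : 0 <= K := le_trans (normr_ge0 _) (aK 0).
exists (K + `|L| * (1 + `|c|) + 1), 1%N; split=> [|z z'].
  by rewrite ltr_wpDl // addr_ge0 // mulr_ge0 // addr_ge0.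
rewrite !expr1.
have -> : a (lsubmx z) * (rsubmx z 0 0 - c) -
    a (lsubmx z') * (rsubmx z' 0 0 - c) =
  a (lsubmx z) * (rsubmx (z - z') 0 0) +
  (a (lsubmx z) - a (lsubmx z')) * (rsubmx z' 0 0 - c) by rewrite !mxE; ring.
have h1 : `|rsubmx (z - z') 0 0| <= `|z - z'| by rewrite mxE coord_le_norm.
have h2 : `|rsubmx z' 0 0 - c| <= `|z'| + `|c|.
  by apply: (le_trans (ler_normB _ _)); rewrite lerD2r mxE coord_le_norm.
have h3 : `|a (lsubmx z) - a (lsubmx z')| <= `|L| * `|z - z'|.
  apply: (le_trans (aL _ _)).
  apply: (le_trans (ler_wpM2r (normr_ge0 _) (ler_norm L))).
  by rewrite ler_wpM2l // -linearB norm_lsubmx_le.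
apply: (le_trans (ler_normD _ _)); rewrite !normrM.
have h4 : `|a (lsubmx z)| * `|rsubmx (z - z') 0 0| <= K * `|z - z'|.
  exact: ler_pM.
have h5 := ler_pM (normr_ge0 _) (normr_ge0 _) h3 h2.
apply: (le_trans (lerD h4 h5)).
move: (normr_ge0 L) (normr_ge0 c) (normr_ge0 z) (normr_ge0 z') (normr_ge0 (z - z')).
move: `|L| `|c| `|z| `|z'| `|z - z'| => l c' u v d l0 c0 u0 v0 d0.
rewrite (mulrAC l) -mulrDl ler_wpM2r //.
have : 0 <= l * c' by rewrite mulr_ge0.
have : 0 <= l * u by rewrite mulr_ge0.
have : 0 <= l * v by rewrite mulr_ge0.
have : 0 <= (l * c') * u by rewrite !mulr_ge0.
have : 0 <= (l * c') * v by rewrite !mulr_ge0.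
have : 0 <= K * u by rewrite mulr_ge0.
have : 0 <= K * v by rewrite mulr_ge0.
by lra.
Qed.

End RowVectors.

(** * Closure properties of the space of random variables *)
Section RandomVariables.
Local Open Scope ring_scope.
Variables (R : realType) (d : measure_display) (Omega : measurableType d).
Variable H : set (Omega -> R).
Hypothesis HH : random_variable_space H.
Implicit Types X Y : Omega -> R.

Lemma rvs_real_comp (f : R -> R) (C : R) X : 0 < C ->
  (forall x y, `|f x - f y| <= C * (1 + `|x| + `|y|) * `|x - y|) ->
  H X -> H (fun w => f (X w)).
Proof.
move=> C0 fC HX.
have := rvs_comp HH (locally_lipschitz_poly_coord C0 fC) (fun _ : 'I_1 => HX).
by under eq_fun do rewrite mxE.
Qed.

Lemma rvs_lipschitz_comp (f : R -> R) (L : R) X :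
  (forall x y, `|f x - f y| <= L * `|x - y|) ->
  H X -> H (fun w => f (X w)).
Proof.
move=> fL; apply: (@rvs_real_comp _ (`|L| + 1)); first by rewrite ltr_wpDl.
move=> x y; apply: (le_trans (fL x y)); rewrite ler_wpM2r //.
have := ler_norm L; have := normr_ge0 L.
by have := normr_ge0 x; have := normr_ge0 y; nra.
Qed.

Lemma rvs_cst (c : R) : H (fun=> c).
Proof.
apply: (@rvs_lipschitz_comp (fun=> c) 1 _ _ (rvs_zero HH)) => x y.
by rewrite subrr normr0 mul1r.
Qed.

Lemma rvs_scale (l : R) X : H X -> H (fun w => l * X w).
Proof.
move=> HX; have := rvs_linear HH l HX (rvs_zero HH).
by under eq_fun do rewrite addr0.
Qed.

Lemma rvs_opp X : H X -> H (fun w => - X w).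
Proof. by move=> /(rvs_scale (-1)); under eq_fun do rewrite mulN1r. Qed.

Lemma rvs_add X Y : H X -> H Y -> H (fun w => X w + Y w).
Proof.
move=> HX HY; have := rvs_linear HH 1 HX HY.
by under eq_fun do rewrite mul1r.
Qed.

Lemma rvs_shift (c : R) X : H X -> H (fun w => X w - c).
Proof. by move=> HX; apply: rvs_add => //; exact: rvs_cst. Qed.

Lemma rvs_sum (m n : nat) (F : nat -> Omega -> R) :
  (forall k, (m <= k < n)%N -> H (F k)) ->
  H (fun w => \sum_(m <= k < n) F k w).
Proof.
move=> HF; rewrite [X in H X](_ : _ = (\sum_(m <= k < n) F k)%R); last first.
  by apply/funext => w; rewrite fct_sumE.
rewrite big_nat_cond; elim/big_ind : _ => [|X Y HX HY|k]; first exact: rvs_zero.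
  exact: rvs_add.
by rewrite andbT => /HF.
Qed.

Lemma rvs_sqr X : H X -> H (fun w => X w ^+ 2).
Proof.
apply: (@rvs_real_comp (fun x => x ^+ 2) 1) => // x y.
rewrite subr_sqr normrM mulrC ler_wpM2r // mul1r.
by apply: (le_trans (ler_normD _ _)); lra.
Qed.

(** By polarization, closure under products reduces to closure under squares,
    a composition with a function of one variable. *)
Lemma rvs_mul X Y : H X -> H Y -> H (fun w => X w * Y w).
Proof.
move=> HX HY.
have := rvs_linear HH (- 2^-1) (rvs_add (rvs_sqr HX) (rvs_sqr HY))
  (rvs_scale 2^-1 (rvs_sqr (rvs_add HX HY))).
by congr H; apply/funext => w; field.
Qed.

Lemma rvs_huber X : H X -> H (fun w => huber (X w)).
Proof.
move=> HX; have Hc : H (fun w => clamp (X w)).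
  by apply: (@rvs_lipschitz_comp _ 1) => // x y; rewrite mul1r clamp_lipschitz.
apply: rvs_mul => //; apply: rvs_add; first exact: rvs_scale.
exact: rvs_opp.
Qed.

Lemma rvs_norm_powR (p : R) X : 1 <= p <= 2 -> H X -> H (fun w => `|X w| `^ p).
Proof.
move=> p12; apply: (@rvs_real_comp (fun x => `|x| `^ p) 2) => // x y.
exact: norm_powR_lipschitz.
Qed.

End RandomVariables.

(** * Sub-linear expectations *)
Section SublinearExpectation.
Variables (R : realType) (d : measure_display) (Omega : measurableType d).
Variables (H : set (Omega -> R)) (E : (Omega -> R) -> \bar R).
Hypothesis HE : sublinear_expectation_space H E.
Implicit Types (X Y : Omega -> R) (a b c l : R).

Let HH : random_variable_space H := HE.1.
Let SE : sublinear_expectation H E := HE.2.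

Lemma sle_ge0 X : H X -> (forall w, (0 <= X w)%R) -> 0 <= E X.
Proof.
move=> HX X0; have := sle_mono SE HX (rvs_cst HH 0%R) X0.
by rewrite (sle_cst SE).
Qed.

(** Real upper bounds on both terms exclude the value [+oo], hence every
    indeterminate sum: in this form sub-additivity has no side condition, even
    if some expectations are [-oo]. *)
Lemma sle_leD X Y a b : H X -> H Y -> E X <= a%:E -> E Y <= b%:E ->
  E (fun w => X w + Y w)%R <= (a + b)%:E.
Proof.
move=> HX HY Xa Yb; rewrite EFinD.
apply: (le_trans _ (leeD Xa Yb)); apply: (sle_subadd SE) => //.
apply: ltpinfty_adde_def; rewrite inE.
  exact: le_lt_trans Xa (ltry _).
exact: le_lt_trans Yb (ltry _).
Qed.

Lemma sle_leZ X l a : H X -> (0 <= l)%R -> E X <= a%:E ->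
  E (fun w => l * X w)%R <= (l * a)%:E.
Proof.
by move=> HX l0 Xa; rewrite (sle_homo SE) // EFinM lee_wpmul2l ?lee_fin.
Qed.

Lemma sle_le_sum (m n : nat) (F : nat -> Omega -> R) (f : nat -> R) :
  (forall k, (m <= k < n)%N -> H (F k)) ->
  (forall k, (m <= k < n)%N -> E (F k) <= (f k)%:E) ->
  E (fun w => \sum_(m <= k < n) F k w)%R <= (\sum_(m <= k < n) f k)%:E.
Proof.
have [nm|mn] := leqP n m.
  move=> _ _; under eq_fun do rewrite big_geq //.
  by rewrite big_geq // (sle_cst SE).
elim: n mn => // n IH; rewrite ltnS => mn HF Ff.
have inm k : (m <= k < n)%N -> (m <= k < n.+1)%N by lia.
under eq_fun do rewrite big_nat_recr //=.
rewrite big_nat_recr //=; apply: sle_leD.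
- by apply: (rvs_sum HH) => k /inm /HF.
- by apply: HF; rewrite mn leqnn.
- move: mn; rewrite leq_eqVlt => /predU1P[->|mn].
    by under eq_fun do rewrite big_geq //; rewrite big_geq // (sle_cst SE).
  by apply: IH => // k /inm; [exact: HF|exact: Ff].
- by apply: Ff; rewrite mn leqnn.
Qed.

Lemma sle_shift X a c : H X -> E X = a%:E ->
  E (fun w => X w - c)%R = (a - c)%:E.
Proof.
move=> HX Xa; apply/eqP; rewrite eq_le; apply/andP; split.
  apply: (@sle_leD X (fun=> - c)%R) => //; first exact: (rvs_cst HH).
    by rewrite Xa.
  by rewrite (sle_cst SE).
have /(_ _ _ (rvs_shift HH c HX) (rvs_cst HH c)) := sle_subadd SE.
rewrite (sle_cst SE) fin_num_adde_defl // => /(_ isT).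
under eq_fun do rewrite subrK.
by rewrite Xa EFinB leeBlDr.
Qed.

Lemma sle_opp_ge0 X : H X -> E X = 0 -> 0 <= E (fun w => - X w)%R.
Proof.
move=> HX X0; have := sle_subadd SE HX (rvs_opp HH HX).
rewrite X0 fin_num_adde_defr // => /(_ isT); rewrite add0e.
by under eq_fun do rewrite subrr; rewrite (sle_cst SE).
Qed.

(** For negative [l] this rests on [0 <= E[X] + E[- X]]. *)
Lemma sle_scale_ge0 X l : H X -> E X = 0 -> 0 <= E (fun w => l * X w)%R.
Proof.
move=> HX X0; have [l0|l0] := leP 0%R l.
  by rewrite (sle_homo SE) // X0 mule0.
under eq_fun do rewrite -mulrNN.
have l1 : (0 <= - l)%R by rewrite oppr_ge0 ltW.
rewrite (sle_homo SE) //; last exact: rvs_opp.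
by rewrite mule_ge0 // ?lee_fin // sle_opp_ge0.
Qed.

(** Integrate the tangent of [huber] at [c = E[X]]: its linear part, whatever
    the sign of the slope, has nonnegative upper expectation. *)
Lemma huber_jensen X a c : H X -> E X = c%:E ->
  E (fun w => huber (X w)) <= a%:E -> (huber c <= a)%R.
Proof.
move=> HX Xc Xa; have HY := rvs_shift HH c HX.
have Y0 : E (fun w => X w - c)%R = 0 by rewrite (sle_shift _ HX Xc) subrr.
pose l := (2 * clamp c)%R.
have HlY : H (fun w => l * (X w - c))%R by exact: rvs_scale.
have h1 : E (fun w => l * (X w - c) + huber c)%R <= a%:E.
  apply: le_trans Xa; apply: (sle_mono SE).
  - exact: rvs_huber.
  - by apply: (rvs_add HH) => //; exact: rvs_cst.
  - by move=> w; rewrite addrC; exact: huber_tangent.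
have := @sle_leD _ (fun=> - huber c)%R a (- huber c)%R
  (rvs_add HH HlY (rvs_cst HH (huber c))) (rvs_cst HH _) h1.
rewrite (sle_cst SE) => /(_ (lexx _)).
under eq_fun do rewrite addrK.
by move=> /(le_trans (sle_scale_ge0 l HY Y0)); rewrite lee_fin subr_ge0.
Qed.

(** With the past frozen at [x], the upper expectation of [f x (Y - c)] is
    [f x E[Y - c] = 0] when [f x >= 0] and [- f x E[c - Y] = - f x (c - c')]
    otherwise, so it equals the negative part of [f x] times [c - c'].  This is a
    bounded random variable when evaluated at the past, as the definition of
    independence requires. *)
Lemma independent_drift (m : nat) (X : 'I_m -> Omega -> R) Y
    (f : 'rV[R]_m -> R) (L c c' : R) :
  independent_to H E (fun _ : 'I_1 => Y) X ->
  (forall i, H (X i)) -> H Y ->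
  E Y = c%:E -> conjugate_expectation E Y = c'%:E ->
  (forall x, `|f x| <= 1)%R -> (forall x y, `|f x - f y| <= L * `|x - y|)%R ->
  E (fun w => f (random_vector X w) * (Y w - c))%R <= (c - c')%:E.
Proof.
move=> ind HX HY Yc Yc' f1 fL.
have HYc := rvs_shift HH c HY.
have Y0 : E (fun w => Y w - c)%R = 0 by rewrite (sle_shift _ HY Yc) subrr.
have NY : E (fun w => - (Y w - c))%R = (c - c')%:E.
  have -> : (c - c' = - c' - - c)%R by ring.
  rewrite -(@sle_shift (fun w => - Y w)%R) //; last 2 first.
  - exact: rvs_opp.
  - by rewrite EFinN -Yc' /conjugate_expectation oppeK.
  by congr (E _); apply/funext => w; ring.
have cc : (0 <= c - c')%R by rewrite -lee_fin -NY; exact: sle_opp_ge0.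
pose phi := fun z : 'rV[R]_(m + 1) => (f (lsubmx z) * (rsubmx z 0 0 - c))%R.
have phiE x w : phi (row_mx x (random_vector (fun _ : 'I_1 => Y) w)) =
    (f x * (Y w - c))%R by rewrite /phi row_mxKl row_mxKr mxE.
have phibarE x : E (fun w => f x * (Y w - c))%R =
    (Num.max 0 (- f x) * (c - c'))%:E.
  have [fx|fx] := leP 0%R (- f x)%R.
    under eq_fun do rewrite -mulrNN.
    by rewrite (sle_homo SE) ?NY //; exact: rvs_opp.
  rewrite mul0r (sle_homo SE) ?Y0 ?mule0 //.
  by rewrite -oppr_le0 ltW.
pose Z := fun w => (Num.max 0 (- f (random_vector X w)) * (c - c'))%R.
have maxL (x y : R) : (`|Num.max 0 x - Num.max 0 y| <= 1 * `|x - y|)%R.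
  have hp := ler_norm (x - y); have hn := ler_norm (- (x - y)).
  rewrite normrN in hn; rewrite mul1r ler_norml.
  by case: (leP 0%R x) => ?; case: (leP 0%R y) => ?; lra.
have HZ : H Z.
  apply: (rvs_mul HH); last exact: rvs_cst.
  apply: (rvs_lipschitz_comp HH maxL); apply: (rvs_opp HH).
  exact: (rvs_comp HH (lipschitz_locally_poly fL) HX).
have Z01 w : (0 <= Z w <= c - c')%R.
  rewrite /Z; have := f1 (random_vector X w); rewrite ler_norml => /andP[? ?].
  have /andP[m0 m1] : (0 <= Num.max 0 (- f (random_vector X w)) <= 1)%R.
    by case: (leP 0%R (- f (random_vector X w))%R) => ?; lra.
  by rewrite mulr_ge0 // ler_piMl.
have EZ : E Z <= (c - c')%:E.
  rewrite -(sle_cst SE (c - c')%R); apply: (sle_mono SE) => //.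
    exact: rvs_cst.
  by move=> w; case/andP: (Z01 w).
have := ind phi (locally_lipschitz_poly_mul_last c f1 fL) _ Z HZ.
have -> : (fun w => phi (row_mx (random_vector X w)
    (random_vector (fun _ : 'I_1 => Y) w))) =
  (fun w => f (random_vector X w) * (Y w - c))%R by apply/funext => w.
move=> ->.
- exact: EZ.
- by move=> x; under eq_fun do rewrite phiE; rewrite phibarE ltry.
- by move=> w; under eq_fun do rewrite phiE; rewrite phibarE.
- have -> : (fun w => `|Z w|)%R = Z.
    by apply/funext => w; rewrite ger0_norm //; case/andP: (Z01 w).
  exact: le_lt_trans EZ (ltry _).
Qed.

End SublinearExpectation.

(** * Smoothly stopped partial sums *)
Section StoppedSums.
Local Open Scope ring_scope.
Variable R : realType.
Implicit Types (N k n : nat) (y : nat -> R).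

Definition block_sum N y k : R := \sum_(N <= j < k) y j.

(** The weight still alive at time [k]: a Lipschitz substitute for the indicator
    that no partial sum of the block has left [[-2, 2]] up to time [k]. *)
Definition survival N y k : R := \prod_(N <= j < k) cutoff (block_sum N y j.+1).

Lemma survival_ge0 N y k : 0 <= survival N y k.
Proof. by apply: prodr_ge0 => j _; exact: cutoff_ge0. Qed.

Lemma survival_le1 N y k : survival N y k <= 1.
Proof. by apply: Num.Theory.prodr_ile1 => j _; rewrite cutoff_ge0 cutoff_le1. Qed.

Lemma survival_eq0 N y k n : (N < k <= n)%N -> 2 <= `|block_sum N y k| ->
  survival N y n = 0.
Proof.
case: k => // k /andP[Nk kn] yk; rewrite /survival.
rewrite (big_cat_nat (n := k) (p := n)) ?(ltnW kn) //= (big_ltn kn).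
by rewrite cutoff_eq0 // mul0r mulr0.
Qed.

Lemma eq_block_sum N y y' k : (forall j, (j < k)%N -> y j = y' j) ->
  block_sum N y k = block_sum N y' k.
Proof. by move=> yy'; apply: eq_big_nat => j /andP[_ /yy']. Qed.

Lemma eq_survival N y y' k : (forall j, (j < k)%N -> y j = y' j) ->
  survival N y k = survival N y' k.
Proof.
move=> yy'; apply: eq_big_nat => j /andP[_ jk]; congr cutoff.
by apply: eq_block_sum => i ij; apply: yy'; exact: leq_trans ij jk.
Qed.

(** The potential [1 - R_k + R_k h(S_k)] starts at [0] and dominates the stopped
    mass [1 - R_k].  In one step, [cutoff_huber] shows that further stopping does
    not increase it, and [huber_taylor] bounds the growth of [h]. *)
Lemma stopping_le_drift N y n : 1 - survival N y n <=
  \sum_(N <= k < n) (2 * (survival N y k * clamp (block_sum N y k)) * y k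
    + 4 * huber (y k)).
Proof.
have [nN|Nn] := ltnP n N.
  by rewrite /survival !big_geq ?(ltnW nN) // subrr.
(* The induction needs the whole potential, not just its stopped mass. *)
suff : 1 - survival N y n + survival N y n * huber (block_sum N y n) <=
  \sum_(N <= k < n) (2 * (survival N y k * clamp (block_sum N y k)) * y k
    + 4 * huber (y k)).
  apply: le_trans; rewrite lerDl mulr_ge0 ?survival_ge0 ?huber_ge0 //.
elim: n Nn => [|n IH].
  by rewrite leqn0 => /eqP ->; rewrite /survival /block_sum !big_geq // huber0; lra.
rewrite leq_eqVlt ltnS => /predU1P[<-|Nn].
  by rewrite /survival /block_sum !big_geq // huber0; lra.
have {}IH := IH Nn; rewrite [leRHS]big_nat_recr //=.
apply: le_trans (lerD IH (lexx _)).
have -> : survival N y n.+1 = survival N y n * cutoff (block_sum N y n.+1).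
  by rewrite /survival big_nat_recr.
have h1 := cutoff_huber (block_sum N y n.+1).
have h2 := huber_taylor (block_sum N y n) (y n).
have sE : block_sum N y n.+1 = block_sum N y n + y n.
  by rewrite /block_sum big_nat_recr.
rewrite -sE in h2.
have s0 := survival_ge0 N y n; have s1 := survival_le1 N y n.
have h3 := ler_wpM2l s0 (le_trans h1 h2).
have := ler_wpM2r (huber_ge0 (y n)) s1.
by lra.
Qed.

Section Lipschitz.
Variables (m : nat).
Implicit Types f g : 'rV[R]_m -> R.

Definition lipschitz_rV f := exists L, forall x x', `|f x - f x'| <= L * `|x - x'|.

Lemma lipschitz_rV_cst (c : R) : lipschitz_rV (fun=> c).
Proof. by exists 0 => x x'; rewrite subrr normr0 mul0r. Qed.

Lemma lipschitz_rV_add f g : lipschitz_rV f -> lipschitz_rV g ->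
  lipschitz_rV (fun x => f x + g x).
Proof.
move=> [L fL] [M gM]; exists (L + M) => x x'; rewrite opprD addrACA mulrDl.
by apply: (le_trans (ler_normD _ _)); exact: lerD.
Qed.

Lemma lipschitz_rV_mul f g : (forall x, `|f x| <= 1) -> (forall x, `|g x| <= 1) ->
  lipschitz_rV f -> lipschitz_rV g -> lipschitz_rV (fun x => f x * g x).
Proof.
move=> f1 g1 [L fL] [M gM]; exists (L + M) => x x'.
have -> : f x * g x - f x' * g x' = (f x - f x') * g x + f x' * (g x - g x').
  by ring.
apply: (le_trans (ler_normD _ _)); rewrite !normrM mulrDl; apply: lerD.
  by apply: le_trans (fL x x'); rewrite ler_piMr.
by apply: le_trans (gM x x'); rewrite ler_piMl.
Qed.

Lemma lipschitz_rV_comp (u : R -> R) f :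
  (forall a b, `|u a - u b| <= `|a - b|) -> lipschitz_rV f ->
  lipschitz_rV (fun x => u (f x)).
Proof. by move=> u1 [L fL]; exists L => x x'; exact: le_trans (u1 _ _) (fL _ _). Qed.

Lemma lipschitz_rV_coord (t c : R) j : lipschitz_rV (fun x => t * (x 0 j - c)).
Proof.
exists `|t| => x x'; rewrite -mulrBr normrM ler_wpM2l //.
have -> : x 0 j - c - (x' 0 j - c) = (x - x') 0 j by rewrite !mxE; ring.
exact: coord_le_norm.
Qed.

Lemma lipschitz_rV_block_sum N (F : nat -> 'rV[R]_m -> R) k :
  (forall j, lipschitz_rV (F j)) ->
  lipschitz_rV (fun x => block_sum N (fun j => F j x) k).
Proof.
move=> FL; elim: k => [|k IH].
  rewrite /block_sum; under eq_fun do rewrite big_geq //.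
  exact: lipschitz_rV_cst.
have [kN|Nk] := ltnP k N.
  rewrite /block_sum; under eq_fun do rewrite big_geq //.
  exact: lipschitz_rV_cst.
rewrite /block_sum; under eq_fun do rewrite big_nat_recr //=.
exact: lipschitz_rV_add.
Qed.

Lemma lipschitz_rV_survival N (F : nat -> 'rV[R]_m -> R) k :
  (forall j, lipschitz_rV (F j)) ->
  lipschitz_rV (fun x => survival N (fun j => F j x) k).
Proof.
move=> FL; elim: k => [|k IH].
  rewrite /survival; under eq_fun do rewrite big_geq //.
  exact: lipschitz_rV_cst.
have [kN|Nk] := ltnP k N.
  rewrite /survival; under eq_fun do rewrite big_geq //.
  exact: lipschitz_rV_cst.
rewrite /survival; under eq_fun do rewrite big_nat_recr //=.
apply: lipschitz_rV_mul => //.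
- by move=> x; rewrite ger0_norm ?survival_ge0 ?survival_le1.
- by move=> x; rewrite ger0_norm ?cutoff_ge0 ?cutoff_le1.
- apply: lipschitz_rV_comp; first exact: cutoff_lipschitz.
  exact: lipschitz_rV_block_sum.
Qed.

End Lipschitz.
End StoppedSums.

(** * The maximal inequality in capacity *)
Section Capacity.
Variables (R : realType) (d : measure_display) (Omega : measurableType d).
Variables (H : set (Omega -> R)) (E : (Omega -> R) -> \bar R).
Hypothesis HE : sublinear_expectation_space H E.

Let HH : random_variable_space H := HE.1.
Let SE : sublinear_expectation H E := HE.2.
Local Notation V := (upper_capacity H E).

Lemma upper_capacity_ge0 A : 0 <= V A.
Proof.
apply/ereal_infP => _ [xi [Hxi xiA] <-]; apply: (sle_ge0 HE Hxi) => w.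
by apply: le_trans (xiA w); rewrite indicE; case: (_ \in _).
Qed.

Lemma le_upper_capacity A B : A `<=` B -> V A <= V B.
Proof.
move=> AB; apply/ereal_infP => _ [xi [Hxi xiB] <-].
apply: ge_ereal_inf; exists (E xi) => //; exists xi => //; split=> // w.
apply: le_trans (xiB w); rewrite !indicE ler_nat.
by case: (boolP (w \in A)) => // /set_mem/AB/mem_set ->.
Qed.

Lemma upper_capacity_le (A : set Omega) xi : H xi ->
  (forall w, 0 <= xi w)%R -> (forall w, A w -> 1 <= xi w)%R -> V A <= E xi.
Proof.
move=> Hxi xi0 xi1; apply: ge_ereal_inf; exists (E xi) => //.
exists xi => //; split=> // w.
rewrite indicE; case: (boolP (w \in A)) => [/set_mem/xi1//|_].
exact: xi0.
Qed.

Variables (X : nat -> Omega -> R) (c c' r : nat -> R) (p : R).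
Hypothesis XH : forall n, H (X n).
Hypothesis Xindep : independent_sequence H E X.
Hypothesis Xc : forall n, E (X n) = (c n)%:E.
Hypothesis Xc' : forall n, conjugate_expectation E (X n) = (c' n)%:E.
Hypothesis p12 : (1 <= p <= 2)%R.
Hypothesis Xr : forall n, E (fun w => `|X n w| `^ p)%R <= (r n)%:E.

Lemma conjugate_le n : (c' n <= c n)%R.
Proof.
have NX : E (fun w => - X n w)%R = (- c' n)%:E.
  by rewrite EFinN -Xc' /conjugate_expectation oppeK.
have := sle_leD HE (XH n) (rvs_opp HH (XH n)) (a := c n) (b := - c' n)%R.
have -> : (fun w => X n w + - X n w)%R = (fun=> 0%R).
  by apply/funext => w; rewrite subrr.
by rewrite Xc NX !lexx (sle_cst SE) lee_fin subr_ge0; exact.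
Qed.

(** Scaling and [huberB] separate [X] from its upper mean; the Jensen inequality
    absorbs the latter, whose series may converge only conditionally. *)
Lemma huber_term_le t n : (1 <= t)%R ->
  E (fun w => huber (t * (X n w - c n)))%R <= (8 * t ^+ 2 * r n)%:E.
Proof.
move=> t1; have Hh : H (fun w => huber (X n w)) by exact: rvs_huber.
have EhX : E (fun w => huber (X n w)) <= (2 * r n)%:E.
  have Hp := rvs_norm_powR HH p12 (XH n).
  apply: le_trans (sle_leZ HE Hp _ (Xr n)); last by [].
  apply: (sle_mono SE) => //; first exact: rvs_scale.
  by move=> w; exact: huber_le_powR.
have hc : (huber (c n) <= 2 * r n)%R := huber_jensen HE (XH n) (Xc n) EhX.
have t0 : (0 <= 2 * t ^+ 2)%R by rewrite mulr_ge0 // sqr_ge0.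
have Hs := rvs_add HH Hh (rvs_cst HH (huber (c n))).
have -> : (8 * t ^+ 2 * r n = 2 * t ^+ 2 * (2 * r n + 2 * r n))%R by ring.
apply: le_trans (sle_leZ HE Hs t0 _).
  apply: (sle_mono SE); [exact: rvs_scale| |move=> w].
    apply: (rvs_huber HH); apply: (rvs_scale HH); exact: rvs_shift.
  apply: (le_trans (huberM _ t1)).
  have := ler_wpM2l (sqr_ge0 t) (huberB (X n w) (c n)).
  by rewrite [leRHS]mulrA [(t ^+ 2 * 2)%R]mulrC.
apply: (sle_leD HE Hh) => //; first exact: rvs_cst.
by rewrite (sle_cst SE) lee_fin.
Qed.

Let Y t w : nat -> R := fun j => (t * (X j w - c j))%R.

(** Exhibits the drift coefficient as a bounded Lipschitz function of the vector
    [(X_0, ..., X_(k-1))].  For indices [j >= k] the value [inord j] is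
    a meaningless default, but only the indices [j < k] enter. *)
Lemma drift_functional N t k : (0 < k)%N ->
  exists2 f : 'rV[R]_k -> R,
    (forall x, `|f x| <= 1)%R /\ lipschitz_rV f &
    forall w, f (random_vector (fun j : 'I_k => X j) w) =
      (survival N (Y t w) k * clamp (block_sum N (Y t w) k))%R.
Proof.
case: k => // k _.
pose F j (x : 'rV[R]_k.+1) : R := (t * (x 0 (inord j) - c j))%R.
have FL j : lipschitz_rV (F j) by exact: lipschitz_rV_coord.
exists (fun x => survival N (fun j => F j x) k.+1 *
  clamp (block_sum N (fun j => F j x) k.+1))%R; first split.
- move=> x; rewrite normrM -[leRHS]mulr1; apply: ler_pM => //.
    by rewrite ger0_norm ?survival_ge0 ?survival_le1.
  exact: clamp_le1.
- apply: lipschitz_rV_mul.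
  + by move=> x; rewrite ger0_norm ?survival_ge0 ?survival_le1.
  + by move=> x; exact: clamp_le1.
  + exact: lipschitz_rV_survival.
  + apply: lipschitz_rV_comp; first exact: clamp_lipschitz.
    exact: lipschitz_rV_block_sum.
- move=> w; have FY j : (j < k.+1)%N ->
      F j (random_vector (fun j : 'I_k.+1 => X j) w) = Y t w j.
    by move=> jk; rewrite /F /Y mxE inordK.
  by rewrite (eq_survival _ FY) (eq_block_sum _ FY).
Qed.

(** Independence speaks of a variable and its nonempty past, hence [0 < N]. *)
Lemma block_capacity_le N n t : (0 < N)%N -> (1 <= t)%R ->
  V [set w | exists2 k, (N < k <= n)%N & (2 <= `|block_sum N (Y t w) k|)%R] <=
  (t ^+ 2 * \sum_(N <= k < n) (2 * (c k - c' k) + 32 * r k))%:E.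
Proof.
move=> N0 t1.
pose D k w := (survival N (Y t w) k * clamp (block_sum N (Y t w) k)
                 * (X k w - c k))%R.
have DP k : (N <= k)%N -> H (D k) /\ E (D k) <= (c k - c' k)%:E.
  case: k => [|k] Nk; first by move: N0; rewrite ltnNge Nk.
  have [f [f1 [L fL]] fE] := drift_functional N t (ltn0Sn k).
  have -> : D k.+1 = (fun w => f (random_vector (fun j : 'I_k.+1 => X j) w) *
      (X k.+1 w - c k.+1))%R by apply/funext => w; rewrite fE.
  split; last exact: (independent_drift HE (@Xindep k)
    (fun j : 'I_k.+1 => XH j) (XH _) (Xc _) (Xc' _) f1 fL).
  apply: (rvs_mul HH); last exact: rvs_shift.
  exact: (rvs_comp HH (lipschitz_locally_poly fL)).
pose G k w := (2 * t * D k w + 4 * huber (Y t w k))%R.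
have Hh k : H (fun w => huber (Y t w k)).
  by apply: (rvs_huber HH); apply: (rvs_scale HH); exact: rvs_shift.
have HG k : (N <= k < n)%N -> H (G k).
  move=> /andP[/DP[HD _] _].
  by apply: (rvs_add HH); apply: (rvs_scale HH).
have GE w : (1 - survival N (Y t w) n <= \sum_(N <= k < n) G k w)%R.
  apply: (le_trans (stopping_le_drift _ _ _)).
  apply: ler_sum => k _; rewrite le_eqVlt; apply/orP; left; apply/eqP.
  by rewrite /G /D /Y; ring.
apply: (@le_trans _ _ (E (fun w => \sum_(N <= k < n) G k w)%R)).
  apply: upper_capacity_le; first exact: (rvs_sum HH).
    move=> w; apply: le_trans (GE w).
    by rewrite subr_ge0 survival_le1.
  move=> w [k Nkn h]; apply: le_trans (GE w).
  by rewrite (survival_eq0 Nkn h) subr0.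
rewrite mulr_sumr; apply: (sle_le_sum HE) => // k kN.
have [HD ED] := DP k (andP kN).1.
have -> : (t ^+ 2 * (2 * (c k - c' k) + 32 * r k) =
  2 * t ^+ 2 * (c k - c' k) + 4 * (8 * t ^+ 2 * r k))%R by ring.
apply: (sle_leD HE); [exact: rvs_scale|exact: rvs_scale| |].
  have t0 : (0 <= 2 * t)%R by lra.
  apply: (le_trans (sle_leZ HE HD t0 ED)); rewrite lee_fin.
  apply: ler_wpM2r; first by rewrite subr_ge0 conjugate_le.
  by nra.
by apply: (sle_leZ HE) => //; exact: huber_term_le.
Qed.

End Capacity.

(** * Convergence of real series by blocks *)
Section SeriesConvergence.
Local Open Scope ring_scope.
Variable R : realType.
Implicit Types u e : nat -> R.

(** The Cauchy criterion with one fixed starting index and countable quantifiers: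
    the same form serves for measurability of the set of convergence.  For
    [k <= N] the block is empty and its sum is [0]. *)
Lemma cvg_series_block_sumP u : cvgn (series u) <->
  forall i, exists N, forall k, `|block_sum N u k| <= 2 ^- i.
Proof.
have sE N k : (N <= k)%N -> series u k - series u N = block_sum N u k.
  by move=> Nk; rewrite sub_series_geq.
split=> [/cvg_ex[l /cvgrPdist_lt ul] i|uc].
  have i0 : 0 < (2 ^- i / 2 : R) by rewrite divr_gt0 // invr_gt0 exprn_gt0.
  have [N _ NP] := ul _ i0; exists N => k.
  have [kN|Nk] := leqP k N; first by
    rewrite /block_sum big_geq // normr0 invr_ge0 exprn_ge0.
  rewrite -sE 1?ltnW //; have := NP k (ltnW Nk); have := NP N (leqnn N).
  by rewrite /= !ltr_norml ler_norml; lra.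
apply: cauchy_cvg; apply: cauchy_exP => eps eps0.
have [i iP] : exists i, (2 ^- i : R) < eps.
  exists (Num.Def.archi_bound eps^-1).
  rewrite invf_plt ?posrE ?exprn_gt0 //.
  by apply: upper_nthrootP.
have [N NP] := uc i; exists (series u N), N => // k /= Nk.
apply: le_lt_trans iP; rewrite distrC sE //; exact: NP.
Qed.

(** Chaining: from the start of block [j] the sums move by at most
    [2^-j + 2^-(j+1) + ... = 2 * 2^-j]. *)
Lemma geometric_blocks_cvg u (N : nat -> nat) (J : nat) :
  (forall j, (N j < N j.+1)%N) ->
  (forall j k, (J <= j)%N -> (N j < k <= N j.+1)%N ->
    `|block_sum (N j) u k| <= 2 ^- j) ->
  cvgn (series u).
Proof.
move=> Ninc uN; apply/cvg_series_block_sumP => i.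
have chain m : forall j k, (J <= j)%N -> (k <= N (j + m))%N ->
    `|block_sum (N j) u k| <= 2 * 2 ^- j.
  elim: m => [|m IH] j k Jj.
    rewrite addn0 => kN.
    by rewrite /block_sum big_geq // normr0 mulr_ge0 // invr_ge0 exprn_ge0.
  rewrite -addSnnS => kN; have j0 : 0 <= (2 ^- j : R) by rewrite invr_ge0 exprn_ge0.
  have [kj|jk] := leqP k (N j).
    by rewrite /block_sum big_geq // normr0 mulr_ge0.
  have [kj1|/ltnW j1k] := leqP k (N j.+1).
    by apply: (le_trans (uN _ _ Jj _)); rewrite ?jk //; lra.
  rewrite /block_sum (big_cat_nat (n := N j.+1)) ?(ltnW (Ninc j)) //=.
  apply: (le_trans (ler_normD _ _)).
  have h1 := uN j (N j.+1) Jj; rewrite Ninc leqnn in h1.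
  have h2 := IH j.+1 k (leqW Jj) kN.
  have h3 : 2 * 2 ^- j.+1 = 2 ^- j :> R by rewrite exprS invfM mulrA divff // mul1r.
  by rewrite h3 in h2; have := lerD (h1 isT) h2; rewrite /block_sum; lra.
pose j := maxn J i.+1; exists (N j) => k.
have jN m : (m <= N m)%N by elim: m => // m IH; exact: leq_ltn_trans IH (Ninc m).
have kN : (k <= N (j + k))%N by apply: leq_trans (jN _); exact: leq_addl.
apply: (le_trans (chain _ _ _ (leq_maxl _ _) kN)).
have ij : (i.+1 <= j)%N by exact: leq_maxr.
rewrite -/j -(subnKC ij) exprD exprS !invfM !mulrA divff // mul1r.
rewrite ler_piMr ?invr_ge0 ?exprn_ge0 //.
by rewrite invf_le1 ?exprn_gt0 // exprn_ege1 // ler1n.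
Qed.

Lemma nneseries_fine_cvg (f : nat -> \bar R) :
  (forall n, 0%R <= f n)%E -> (\sum_(0 <= n <oo) f n < +oo)%E ->
  (forall n, f n \is a fin_num) /\ cvgn (series (fun n => fine (f n))).
Proof.
move=> f0 foo; have part n : (\sum_(0 <= k < n) f k <= \sum_(0 <= k <oo) f k)%E.
  exact: nneseries_lim_ge.
have ffin n : f n \is a fin_num.
  rewrite ge0_fin_numE //; apply: le_lt_trans foo.
  apply: le_trans (part n.+1); rewrite big_nat_recr //=.
  by rewrite leeDr // sume_ge0.
split=> //; apply: nondecreasing_is_cvgn.
  apply: nondecreasing_series => n _ _; exact: fine_ge0.
exists (fine (\sum_(0 <= k <oo) f k)%E) => _ [n _ <-].
rewrite -lee_fin fineK; last first.
  by rewrite ge0_fin_numE // nneseries_ge0.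
apply: le_trans (part n); rewrite /series /= -sumEFin.
by apply: lee_sum => k _; rewrite fineK.
Qed.

(** The exponent [2 (j + 1) + (j + 1)] leaves room for the factor
    [t^2 = 2^(2 (j + 1))] of the maximal inequality at scale [t = 2^(j+1)], and
    then for the bound [2^-(j+1)]. *)
Lemma fast_block_ends e : (forall k, 0 <= e k) -> cvgn (series e) ->
  exists N : nat -> nat, [/\ (0 < N 0)%N, (forall j, (N j < N j.+1)%N) &
    forall j n, \sum_(N j <= k < n) e k <= 2 ^- (j.*2.+2 + j.+1)].
Proof.
move=> e0 /cvg_series_block_sumP ec.
(* [M i] is a start of the tail below [2^-i]; summing the [M i] makes the block
   ends strictly increasing while staying beyond each of them. *)
pose M i := projT1 (cid (ec i)).
have MP i : forall k, `|block_sum (M i) e k| <= 2 ^- i := projT2 (cid (ec i)).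
pose N j := (\sum_(i < j.+1) (M (i.*2.+2 + i.+1)).+1)%N.
have Ninc j : (N j < N j.+1)%N.
  by rewrite /N [ltnRHS]big_ord_recr /= addnS ltnS leq_addr.
exists N; split=> // [|j n]; first by rewrite /N big_ord_recr /= addnS.
set i := (_ + _)%N.
have MN : (M i <= N j)%N.
  by rewrite /N big_ord_recr /= -/i addnS ltnW // ltnS leq_addl.
apply: le_trans (MP i n); apply: le_trans (ler_norm _); rewrite /block_sum.
have [nN|Nn] := leqP n (N j); first by rewrite big_geq // sumr_ge0.
by rewrite [leRHS](big_cat_nat (n := N j)) ?(ltnW Nn) //= lerDr sumr_ge0.
Qed.

End SeriesConvergence.

(** * Measurability and Borel-Cantelli *)
Section AlmostSure.
Variables (R : realType) (d : measure_display) (Omega : measurableType d).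
Variable H : set (Omega -> R).

Lemma rvs_norm_block_sum_measurable (u : nat -> Omega -> R) N k (a : R) :
  random_variable_space H -> (forall n, H (u n)) ->
  measurable [set w | `|block_sum N (fun j => u j w) k| <= a]%R.
Proof.
move=> HH uH; pose Z w : R := `|block_sum N (fun j => u j w) k|%R.
have HZ : H Z.
  apply: (@rvs_lipschitz_comp _ _ _ _ HH Num.norm 1%R).
    by move=> x y; rewrite mul1r ler_dist_dist.
  exact: (rvs_sum HH).
have := rvs_measurable HH HZ measurableT (measurable_itv `]-oo, a]).
by rewrite setTI; congr (measurable _); apply/seteqP; split => w; rewrite /= in_itv.
Qed.

Lemma rvs_series_cvg_measurable (u : nat -> Omega -> R) :
  random_variable_space H -> (forall n, H (u n)) ->
  measurable [set w | cvgn (series (fun n => u n w))].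
Proof.
move=> HH uH.
rewrite (_ : [set w | _] = \bigcap_i \bigcup_N \bigcap_k
  [set w | `|block_sum N (fun j => u j w) k| <= 2 ^- i]%R).
  apply: bigcapT_measurable => i; apply: bigcupT_measurable => N.
  by apply: bigcapT_measurable => k; exact: rvs_norm_block_sum_measurable.
apply/seteqP; split => w /=.
  move=> /cvg_series_block_sumP uc i _; have [N NP] := uc i.
  by exists N => // k _; exact: NP.
move=> uc; apply/cvg_series_block_sumP => i; have [N _ NP] := uc i I.
by exists N => k; exact: NP.
Qed.

Variable E : (Omega -> R) -> \bar R.
Hypothesis HE : sublinear_expectation_space H E.
Local Notation V := (upper_capacity H E).

Lemma capacity_borel_cantelli (A : nat -> set Omega) (B : set Omega) :
  countably_subadditive V -> (forall j, measurable (A j)) ->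
  (forall j, V (A j) <= (2 ^- j.+1)%:E) ->
  (forall J, B `<=` \bigcup_j A (J + j)%N) ->
  V B = 0.
Proof.
move=> Vsub mA VA BA; apply/eqP; rewrite eq_le upper_capacity_ge0 // andbT.
have VB J : V B <= (2 ^- J)%:E.
  apply: (le_trans (le_upper_capacity H E (BA J))).
  apply: (le_trans (Vsub _ (fun j => mA (J + j)%N))).
  have J0 : (0 <= 2 ^- J :> R)%R by rewrite invr_ge0 exprn_ge0.
  apply: le_trans (epsilon_trick0 xpredT J0).
  apply: lee_nneseries => [j _ _|j _]; first exact: (upper_capacity_ge0 HE).
  by apply: (le_trans (VA _)); rewrite lee_fin -addnS exprD invfM natrX.
apply/lee_addgt0Pr => e e0; rewrite add0e.
apply: (le_trans (VB (Num.Def.archi_bound e^-1))); rewrite lee_fin ltW //.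
by rewrite invf_plt ?posrE ?exprn_gt0 //; apply: upper_nthrootP.
Qed.

End AlmostSure.

Unset Implicit Arguments.
Set Strict Implicit.
Set Printing Implicit Defensive.

Theorem theorem3p1 (R : realType) (d : measure_display)
    (Omega : measurableType d) (H : set (Omega -> R))
    (E : (Omega -> R) -> \bar R)
    (HE : sublinear_expectation_space H E)
    (X : nat -> Omega -> R)
    (XH : forall n, H (X n))
    (Xindep : independent_sequence H E X)
    (Vsub : countably_subadditive (upper_capacity H E))
    (EX_cvg : real_series_converges (fun n => E (X n)))
    (cEX_cvg : real_series_converges
      (fun n => conjugate_expectation E (X n)))
    (Xp : exists p : R, (1 <= p <= 2)%R /\
      \sum_(0 <= n <oo) E (fun w => (`|X n w| `^ p)%R) < +oo) :
  almost_surely_in_capacity (upper_capacity H E)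
    (fun w => cvgn (series (fun n => X n w))).
Proof.
have HH := HE.1; have [p [p12 Xpoo]] := Xp.
have [Xfin c_cvg] := EX_cvg; have [X'fin c'_cvg] := cEX_cvg.
pose c n := fine (E (X n)); pose c' n := fine (conjugate_expectation E (X n)).
pose r n := fine (E (fun w => (`|X n w| `^ p)%R)).
have Xc n : E (X n) = (c n)%:E by rewrite fineK.
have Xc' n : conjugate_expectation E (X n) = (c' n)%:E by rewrite fineK.
have Xp0 n : 0 <= E (fun w => (`|X n w| `^ p)%R).
  by apply: (sle_ge0 HE) => [|w]; [exact: rvs_norm_powR|exact: powR_ge0].
have [rfin r_cvg] := nneseries_fine_cvg Xp0 Xpoo.
have Xr n : E (fun w => (`|X n w| `^ p)%R) <= (r n)%:E by rewrite fineK.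
(* The summand of the maximal inequality. *)
pose e := (2%R *: (c - c') + 32%R *: r)%R : nat -> R.
have e_cvg : cvgn (series e).
  by apply: is_cvg_seriesD; apply: is_cvg_seriesZ => //; exact: is_cvg_seriesB.
have eE k : e k = (2 * (c k - c' k) + 32 * r k)%R by [].
have e0 k : (0 <= e k)%R.
  rewrite eE addr_ge0 // mulr_ge0 // ?subr_ge0 ?fine_ge0 //.
  exact: (conjugate_le HE XH Xc Xc').
have [N [N0 Ninc Ntail]] := fast_block_ends e0 e_cvg.
pose Y n w := (X n w - c n)%R.
have YH n : H (Y n) by exact: rvs_shift.
pose A j := \bigcup_(k in [set k | N j < k <= N j.+1]%N)
  ~` [set w | `|block_sum (N j) (fun i => Y i w) k| <= 2 ^- j]%R.
have mA j : measurable (A j).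
  apply: bigcup_measurable => k _; apply: measurableC.
  exact: rvs_norm_block_sum_measurable HH YH.
have Npos j : (0 < N j)%N by elim: j => // j; move/leq_trans; apply; exact: ltnW.
have VA j : upper_capacity H E (A j) <= (2 ^- j.+1)%:E.
  (* The factor [t] turns the threshold [2^-j] into the threshold [2]. *)
  pose t : R := (2 ^+ j.+1)%R; have t1 : (1 <= t)%R by rewrite exprn_ege1 // ler1n.
  have := block_capacity_le HE XH Xindep Xc Xc' p12 Xr (N j.+1) (Npos j) t1.
  move=> VN; apply: le_trans (le_trans VN _).
    apply: le_upper_capacity => w [k Nk /= /negP]; rewrite -ltNge => Yk.
    exists k => //; rewrite /block_sum -mulr_sumr normrM.
    rewrite (ger0_norm (le_trans ler01 t1)) ltW //.
    rewrite -ltr_pdivrMl; last exact: lt_le_trans ltr01 t1.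
    by rewrite /t exprS invfM mulrAC mulVf // mul1r.
  rewrite lee_fin (le_trans (ler_wpM2l (sqr_ge0 t) (Ntail j (N j.+1)))) //.
  rewrite /t -exprM exprD invfM mulrA muln2 doubleS divff ?mul1r //.
split.
  rewrite (_ : [set w | _] = ~` [set w | cvgn (series (fun n => X n w))]) //.
  by apply: measurableC; exact: rvs_series_cvg_measurable HH XH.
apply: (capacity_borel_cantelli HE Vsub mA VA) => J w; apply: contra_notP => wA.
have Y_cvg : cvgn (series (fun n => Y n w)).
  apply: (@geometric_blocks_cvg _ _ N J Ninc) => j k Jj Nk.
  apply: contrapT => Yk; apply: wA; exists (j - J)%N => //.
  by rewrite subnKC //; exists k.
rewrite (_ : (fun n => X n w) = ((fun n => Y n w) + c)%R).
  exact: is_cvg_seriesD.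
by apply/funext => n; rewrite /= fctE subrK.
Qed.
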